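(* Let $k\ge2$, $n\ge1$ be integers, let $\bar{\mathcal{P}}\in\mathbb{R}^{[k,n]}$ be a columnwise-substochastic tensor, $\mathbf{v}\in\mathbb{R}^n$ a stochastic vector and $\alpha\in[0,1)$. Then the MLPPR system $(\mathbf{e}^T\mathbf{y})^{k-2}\mathbf{y}-\alpha\bar{\mathcal{P}}\mathbf{y}^{k-1}=\mathbf{v}$ has at least one nonzero solution $\mathbf{y}_*\in\mathbb{R}^n_+$.
   Context: For $\mathcal{P}\in\mathbb{R}^{[k,n]}$ (real tensors of order $k$, dimension $n$) and $\mathbf{y}\in\mathbb{R}^n$, $(\mathcal{P}\mathbf{y}^{k-1})_i=\sum_{i_2,\dots,i_k}p_{i i_2\dots i_k}y_{i_2}\cdots y_{i_k}$. $\bar{\mathcal{P}}$ is columnwise-substochastic if its entries are nonnegative and $\sum_{i}\bar p_{i i_2\dots i_k}\le1$ for all $i_2,\dots,i_k$. $\mathbf{e}$ is the all-ones vector; a stochastic vector is nonnegative with entries summing to $1$. The MLPPR system $(I\circ\mathbf{e}^{\circ(k-2)}-\alpha\bar{\mathcal{P}})\mathbf{y}^{k-1}=\mathbf{v}$ is exactly $(\mathbf{e}^T\mathbf{y})^{k-2}\mathbf{y}-\alpha\bar{\mathcal{P}}\mathbf{y}^{k-1}=\mathbf{v}$. *)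

(* Defs.v *)
From mathcomp Require Import all_boot all_order all_algebra.
From mathcomp Require Import reals.
Set Implicit Arguments. Unset Strict Implicit. Unset Printing Implicit Defensive.
Import Order.TTheory GRing.Theory Num.Theory.
Local Open Scope ring_scope.

(* A real tensor of order k and dimension n: entries p_{i i_2 ... i_k},
   represented as P i t where t : (k-1).-tuple 'I_n lists (i_2,...,i_k). *)
Definition tensor (R : Type) (k n : nat) := 'I_n -> (k.-1).-tuple 'I_n -> R.

Definition tapply (R : realType) (k n : nat) (P : tensor R k n)
  (y : 'I_n -> R) (i : 'I_n) : R :=
  \sum_(t : (k.-1).-tuple 'I_n) P i t * \prod_(j <- t) y j.

Definition col_substochastic (R : realType) (k n : nat) (P : tensor R k n) :=
  (forall i t, 0 <= P i t) /\ (forall t, \sum_(i < n) P i t <= 1).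

Definition stochastic_vec (R : realType) (n : nat) (v : 'I_n -> R) :=
  (forall i, 0 <= v i) /\ \sum_(i < n) v i = 1.

Definition mlppr_sol (R : realType) (k n : nat) (alpha : R) (P : tensor R k n)
  (v y : 'I_n -> R) :=
  forall i, (\sum_(j < n) y j) ^+ (k - 2) * y i - alpha * tapply P y i = v i.

(* Main.v *)
(** Dividing a solution [y] by its sum gives a stochastic fixed point of
    [x |-> alpha P x^(k-1) + (1 - alpha e^T P x^(k-1)) v].  This map sends the
    standard simplex to itself, so Brouwer's theorem provides a fixed point [x],
    and [y := s x] with [s^(k-1) (1 - alpha e^T P x^(k-1)) = 1] solves the system.

    Brouwer's theorem on the simplex comes from Scarf's lemma on a finite set
    carrying one linear order for each color.  A set [S] is dominant if every
    point is below all of [S] in some order.  A parity count in the style of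
    Sperner, over the pairs of a dominant set with as many elements as there are
    colors and a point removed from it, yields a dominant set containing all
    colors.  For the grid points of the simplex, ordered by their coordinates and
    colored by a coordinate [i] with [x_i <= F(x)_i], a dominant set has small
    diameter, and a cluster point [z] of such sets for finer and finer grids
    satisfies [z_i <= F(z)_i] for all [i], hence [F z = z]. *)

Require Import Defs.
From mathcomp Require Import all_boot all_order all_algebra.
From mathcomp Require Import reals.
From mathcomp Require Import zify lra.
Import Order.TTheory GRing.Theory Num.Theory.

(** * Scarf's lemma *)

Section Scarf.
Variables (U I : finType) (f : I -> U -> nat).
Hypothesis f_inj : forall i, injective (f i).

Definition dominant (S : {set U}) : bool :=
  [forall y, [exists i, [forall s in S, f i y <= f i s]]].

Lemma dominantP (S : {set U}) :
  reflect (forall y, exists i, forall s, s \in S -> f i y <= f i s)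
    (dominant S).
Proof.
apply: (iffP forallP) => h y.
  by have /existsP [i /forall_inP hi] := h y; exists i.
by have [i hi] := h y; apply/existsP; exists i; apply/forall_inP.
Qed.

Lemma dominantS (A B : {set U}) : A \subset B -> dominant B -> dominant A.
Proof.
move=> /subsetP sAB /dominantP h; apply/dominantP => y.
by have [i hi] := h y; exists i => s /sAB; apply: hi.
Qed.

(* The map [mn] sending an order to the minimum of [D] in it is onto [D] by
   dominance, so exactly two orders [p], [q] share a minimum.  A point [y] that
   keeps [D] dominant must become the new minimum in order [p] or in order [q],
   and it is then the largest candidate [Y p], resp. [Y q]. *)
Lemma card_dominant_setU1 (D : {set U}) (x : U) :
  dominant D -> #|D|.+1 = #|I| -> x \in D ->
  (forall l, exists y, forall m, m != l -> f m x < f m y) ->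
  #|[set y | (y \notin D) && dominant (y |: D)]| = 2.
Proof.
move=> domD cardD xD xtop.
pose mn i := [arg min_(s < x in D) f i s].
have mnD i : mn i \in D by rewrite /mn; case: arg_minnP.
have mn_le i s : s \in D -> f i (mn i) <= f i s.
  by rewrite /mn; case: arg_minnP => // z _ h /h.
have mnE i s : s \in D -> (forall s', s' \in D -> f i s <= f i s') -> s = mn i.
  move=> sD hs; apply: (f_inj i); apply/eqP; rewrite eqn_leq mn_le // andbT.
  exact: hs.
have mn_onto s : s \in D -> exists i, s = mn i.
  move=> sD; have /dominantP /(_ s) [i hi] := domD; exists i; exact: mnE.
have mn_im (A : {set I}) : (forall i, exists2 j, j \in A & mn i = mn j) ->
    mn @: A = D.
  move=> hA; apply/setP => s; apply/imsetP/idP => [[i _ ->]//|].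
  by move=> /mn_onto [i ->]; apply: hA.
have /injectivePn [p [q npq epq]] : ~~ injectiveb mn.
  apply/negP => /injectiveP inj.
  have := card_imset [set: I] inj.
  by rewrite cardsT mn_im => [|i]; [lia | exists i].
(* Dropping one of two orders with the same minimum leaves exactly [#|D|] orders, and these still
   map onto [D]. *)
have inj_off l l' : l != l' -> mn l = mn l' -> {in [set~ l] &, injective mn}.
  move=> nll ell; apply/imset_injP; rewrite mn_im => [|i].
    by rewrite cardsC1 -cardD.
  have [->|nil] := eqVneq i l; first by exists l'; rewrite ?inE // eq_sym.
  by exists i; rewrite ?inE.
(* Candidates for a new minimum in order [l]: since [D] is dominant, such a point is below all of
   [D] in order [l] ([M_dom]). The hypothesis on [x] makes [M l] nonempty. *)
pose M l := [set y | [forall m, (m != l) ==> (f m (mn m) < f m y)]].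
have MP l y : reflect (forall m, m != l -> f m (mn m) < f m y) (y \in M l).
  by rewrite inE; apply: (iffP forall_inP).
have Mex l : {y0 | y0 \in M l}.
  apply/sigW; have [y hy] := xtop l; exists y; apply/MP => m /hy.
  exact: leq_ltn_trans (mn_le _ _ xD).
pose Y l := [arg max_(y > sval (Mex l) in M l) f l y].
have YM l : Y l \in M l.
  by rewrite /Y; case: arg_maxnP => //; exact: (svalP (Mex l)).
have Ymax l z : z \in M l -> f l z <= f l (Y l).
  rewrite /Y; case: arg_maxnP => [|y _ h /h//]; exact: (svalP (Mex l)).
have M_dom l z : z \in M l -> forall s, s \in D -> f l z <= f l s.
  move=> /MP zM; have /dominantP /(_ z) [i hi] := domD.
  suff <- : i = l by [].
  by apply/eqP; apply: contraT => /zM; rewrite ltnNge hi.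
have Yok l l' : l != l' -> mn l = mn l' ->
    (Y l \notin D) && dominant (Y l |: D).
  move=> nll ell; apply/andP; split.
    apply/negP => YD; have e := mnE l _ YD (M_dom l _ (YM l)).
    have /MP /(_ l') := YM l; rewrite eq_sym nll => /(_ isT).
    by rewrite -ell -e ltnn.
  apply/dominantP => z; have [zM|] := boolP (z \in M l).
    exists l => s; rewrite in_setU1 => /predU1P [->|]; first exact: Ymax.
    exact: M_dom.
  rewrite inE negb_forall => /existsP [m]; rewrite negb_imply -leqNgt.
  case/andP=> nml hz; exists m => s; rewrite in_setU1 => /predU1P [->|sD].
    by apply: leq_trans hz (ltnW _); have /MP := YM l; apply.
  by apply: leq_trans hz _; apply: mn_le.
suff -> : [set y | (y \notin D) && dominant (y |: D)] = [set Y p; Y q].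
  (* A common value of [Y p] and [Y q] would beat the minimum of [D] in every order, against
     dominance. *)
  rewrite cards2; case: eqVneq => // eY; exfalso.
  have /dominantP /(_ (Y p)) [i /(_ _ (mnD i))] := domD.
  rewrite leqNgt; have [->|nip] := eqVneq i p.
    by rewrite eY; have /MP -> := YM q.
  by have /MP -> := YM p.
apply/setP => y; rewrite in_set2 inE; apply/idP/orP; last first.
  by case=> /eqP ->; [apply: (Yok p q) | apply: (Yok q p); rewrite // eq_sym].
case/andP=> yD /dominantP domy.
have [l hl] := domy y.
have yl s : s \in D -> f l y < f l s.
  move=> sD; rewrite ltn_neqAle hl ?in_setU1 ?sD ?orbT // andbT.
  by apply: contraNneq yD => /f_inj ->.
(* An order in which [mn m'] is below [y |: D] has [mn m'] as its minimum over [D], and cannot be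
   [l], where [y] is lowest. So [mn] is onto [D] even without [l], which forces [l] to be [p] or
   [q]. *)
have steal m' : exists m, [/\ m != l, mn m = mn m' & f m (mn m) < f m y].
  have [m hm] := domy (mn m').
  have e : mn m' = mn m.
    by apply: mnE => // s sD; apply: hm; rewrite in_setU1 sD orbT.
  exists m; rewrite -e; split=> //.
    apply/eqP => em; have := hm y; rewrite in_setU1 eqxx => /(_ isT).
    by rewrite em leqNgt yl.
  rewrite ltn_neqAle hm ?in_setU1 ?eqxx // andbT.
  by apply: contraNneq yD => /f_inj <-.
have lpq : (l == p) || (l == q).
  have [m [nml em _]] := steal l.
  apply: contraT; rewrite negb_or => /andP [nlp nlq].
  have [emp|nmp] := eqVneq m p; last first.
    by move: nml; rewrite (inj_off p q npq epq m l _ _ em) ?inE ?eqxx.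
  by move: nml; rewrite (inj_off q p _ (esym epq) m l _ _ em) ?inE ?eqxx
    // ?emp // eq_sym.
have [l' nll ell] : exists2 l', l != l' & mn l = mn l'.
  by case/orP: lpq => /eqP ->; [exists q | exists p; rewrite // eq_sym].
have -> : y = Y l; last by case/orP: lpq => /eqP ->; [left|right].
have yM : y \in M l.
  apply/MP => m' nm'; have [m [nml em]] := steal m'.
  by rewrite (inj_off l l' nll ell m m' _ _ em) ?inE.
apply: (f_inj l); apply/eqP; rewrite eqn_leq Ymax //=.
have [i hi] := domy (Y l).
suff e : i = l by have := hi y (setU11 _ _); rewrite e.
apply/eqP; apply: contraT => nil.
have /MP /(_ i nil) := YM l.
by rewrite ltnNge hi // in_setU1 mnD orbT.
Qed.

(** Double counting: a set with a marked element is the same as the facet left by its removal with a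
    marked outside point. *)
Lemma sum_set_exchange (F : {set U} -> U -> nat) :
  \sum_(S : {set U}) \sum_(s in S) F S s =
  \sum_(D : {set U}) \sum_(s | s \notin D) F (s |: D) s.
Proof.
rewrite (exchange_big_dep predT) //= [RHS](exchange_big_dep predT) //=.
apply: eq_bigr => s _.
rewrite (reindex_onto (fun D => s |: D) (fun S => S :\ s)) => [|S sS].
  apply: eq_bigl => D; rewrite setU11 /=; apply/eqP/idP => [<-|sD].
    by rewrite !inE eqxx.
  exact: setU1K.
exact: setD1K.
Qed.

Variables (c : U -> I) (i0 : I).

(** If [S] has all colors, only the point of color [i0] can be removed. Otherwise a removable point
    shares its color with exactly one other point of [S], and these two are the only removable
    ones. *)
Lemma odd_panchromatic_facets (S : {set U}) : #|S| = #|I| ->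
  odd (\sum_(s in S) (c @: (S :\ s) == [set~ i0])) = (c @: S == [set: I]).
Proof.
move=> cardS; rewrite -big_mkcondr sum1_card -cardsE; set Z := finset _.
have ZE s : (s \in Z) = (s \in S) && (c @: (S :\ s) == [set~ i0]).
  by rewrite inE.
have injP s : s \in S -> c @: (S :\ s) = [set~ i0] ->
    {in S :\ s &, injective c}.
  move=> sS e; apply/imset_injP; rewrite e cardsC1 -cardS (cardsD1 s S) sS.
  by rewrite add1n.
have [full|nfull] := eqVneq (c @: S) [set: I].
  have inj : {in S &, injective c} by apply/imset_injP; rewrite full cardsT cardS.
  have /imsetP [s sS es] : i0 \in c @: S by rewrite full inE.
  suff -> : Z = [set s] by rewrite cards1.
  apply/setP => z; rewrite ZE inE.
  apply/andP/eqP => [[zS /eqP e]|->]; last first.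
    split=> //; apply/eqP/setP => i; rewrite !inE; apply/imsetP/idP.
      move=> [y]; rewrite !inE => /andP [nys yS] ->; rewrite es.
      by apply: contra nys => /eqP /inj ->.
    move=> ni; have /imsetP [y yS ey] : i \in c @: S by rewrite full inE.
    exists y => //; rewrite !inE yS andbT; apply: contraNneq ni => eys.
    by rewrite ey es eys.
  apply/eqP; apply: contraT => nzs.
  have : i0 \in c @: (S :\ z).
    by apply/imsetP; exists s; rewrite // !inE sS eq_sym nzs.
  by rewrite e !inE eqxx.
have [->|/set0Pn [s0]] := eqVneq Z set0; first by rewrite cards0.
rewrite ZE => /andP [s0S /eqP e0].
have cs0 : c s0 \in c @: (S :\ s0).
  rewrite e0 !inE; apply: contra nfull => /eqP es0.
  apply/eqP/setP => i; rewrite inE -(setD1K s0S) imsetU1 e0 !inE es0.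
  by rewrite orbN.
have /imsetP [s1 s1S es1] := cs0.
have := s1S; rewrite !inE => /andP [n10 s1S'].
have -> : Z = [set s0; s1].
  apply/setP => z; rewrite ZE in_set2; apply/andP/orP; last first.
    case=> /eqP ->; first by rewrite e0.
    split=> //; rewrite -e0; apply/eqP/setP => i; apply/imsetP/imsetP => -[y].
      rewrite !inE => /andP [ny yS ->].
      have [->|n0] := eqVneq y s0; first by exists s1.
      by exists y; rewrite // !inE n0.
    rewrite !inE => /andP [ny yS ->].
    have [->|n1] := eqVneq y s1; last by exists y; rewrite // !inE n1.
    by exists s0; rewrite // !inE s0S eq_sym n10.
  move=> [zS /eqP ez]; apply/orP; apply: contraT; rewrite negb_or.
  case/andP=> nz0 nz1.
  have zS0 : z \in S :\ s0 by rewrite !inE nz0.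
  have : c z \in c @: (S :\ z) by rewrite ez -e0; apply: imset_f.
  case/imsetP=> y; rewrite !inE => /andP [nyz yS] ey.
  have [ey0|ny0] := eqVneq y s0.
    by move: nz1; rewrite (injP s0 s0S e0 z s1) ?eqxx // ey ey0.
  by move: nyz; rewrite (injP s0 s0S e0 y z) ?eqxx // !inE ny0.
by rewrite cards2 eq_sym n10.
Qed.

(** The slack points [a i] act as the boundary: they provide the single facet from which the parity
    count starts. *)
Variable a : I -> U.
Hypothesis ac : cancel a c.
Hypothesis a_min : forall i u, f i (a i) <= f i u.
Hypothesis a_top :
  forall i j u, (forall l, u != a l) -> i != j -> f i u < f i (a j).
Variable u0 : U.
Hypothesis u0a : forall l, u0 != a l.

(** The only completion is the nonslack point largest in order [i0]: a nonslack point is strictly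
    above [a l] in order [l], so only order [i0] can place it below the set. Adding [a i0] instead
    fails at [u0]. *)
Lemma card_dominant_slack :
  #|[set y | (y \notin a @: [set~ i0]) && dominant (y |: a @: [set~ i0])]| = 1.
Proof.
have u0P : [forall l, u0 != a l] by apply/forallP.
pose t := [arg max_(u > u0 | [forall l, u != a l]) f i0 u].
have ta l : t != a l.
  by rewrite /t; case: arg_maxnP => // u /forallP.
have tmax u : (forall l, u != a l) -> f i0 u <= f i0 t.
  by move=> /forallP ua; rewrite /t; case: arg_maxnP => // z _ h; apply: h.
have slackP l : l != i0 -> a l \in a @: [set~ i0].
  by move=> nl; apply: imset_f; rewrite !inE.
suff -> : [set y | (y \notin a @: [set~ i0]) && dominant (y |: a @: [set~ i0])]
    = [set t] by rewrite cards1.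
apply/setP => y; rewrite !inE; apply/andP/eqP => [[yS /dominantP domy]|->].
  have strict u l : (forall m, u != a m) -> f l u <= f l (a l) -> False.
    move=> ua h; have := ua l; rewrite -(inj_eq (f_inj l)).
    by rewrite eqn_leq h a_min.
  have sl l : l != i0 -> a l \in y |: a @: [set~ i0].
    by move=> nl; rewrite in_setU1 slackP ?orbT.
  have ya l : y != a l.
    apply/eqP => ey; have [eli|nl] := eqVneq l i0; last first.
      by move: yS; rewrite ey slackP.
    have [i hi] := domy u0; apply: (strict u0 i u0a); apply: hi.
    have [->|/sl//] := eqVneq i i0; by rewrite -eli -ey in_setU1 eqxx.
  apply: (f_inj i0); apply/eqP; rewrite eqn_leq tmax //=.
  have [i hi] := domy t; have [ei|/sl /hi /(strict t i ta)//] := eqVneq i i0.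
  by rewrite -ei hi // in_setU1 eqxx.
split; first by apply/imsetP => -[l _ /eqP]; rewrite (negbTE (ta l)).
apply/dominantP => z; have [/forallP za|] := boolP [forall l, z != a l].
  exists i0 => s; rewrite in_setU1 => /predU1P [->|]; first exact: tmax.
  case/imsetP=> l; rewrite !inE => nl ->; apply/ltnW/a_top => //.
  by rewrite eq_sym.
rewrite negb_forall => /existsP [l]; rewrite negbK => /eqP ->.
by exists l => s _.
Qed.

Theorem scarf : exists2 S : {set U}, dominant S & c @: S = [set: I].
Proof.
(* Summed by [S], this has the parity of the number of dominant sets of size [#|I|] with all colors.
   Summed by facets, only the slack facet contributes an odd amount. *)
pose F (S : {set U}) (s : U) : nat :=
  [&& dominant S, #|S| == #|I| & c @: (S :\ s) == [set~ i0]].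
suff : odd (\sum_(S : {set U}) \sum_(s in S) F S s).
  move=> oddF.
  have /existsP [S /andP [dS /eqP cS]] :
      [exists S : {set U}, dominant S && (c @: S == [set: I])]; last by exists S.
  apply: contraLR oddF; rewrite negb_exists => /forallP noS.
  elim/big_ind: _ => // [m n em en|S _]; first by rewrite oddD (negbTE em).
  have [dS|ndS] := boolP (dominant S); last first.
    by rewrite big1 // => s _; rewrite /F (negbTE ndS).
  have [/eqP cS|ncS] := boolP (#|S| == #|I|); last first.
    by rewrite big1 // => s _; rewrite /F (negbTE ncS) andbF.
  under eq_bigr do rewrite /F dS cS eqxx.
  by rewrite odd_panchromatic_facets // -[_ == _]andTb -dS noS.
rewrite sum_set_exchange.
have FE (D : {set U}) s : s \notin D -> F (s |: D) s =
    ((#|D|.+1 == #|I|) && (c @: D == [set~ i0])) * dominant (s |: D).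
  move=> sD; rewrite /F cardsU1 sD setU1K // add1n mulnb.
  by rewrite andbC.
have sumE (D : {set U}) : \sum_(s | s \notin D) F (s |: D) s =
    ((#|D|.+1 == #|I|) && (c @: D == [set~ i0])) *
      #|[set y | (y \notin D) && dominant (y |: D)]|.
  rewrite (eq_bigr _ (FE D)) -big_distrr /= -big_mkcondr sum1_card.
  by congr (_ * _); apply: eq_card => y; rewrite !inE.
have a_inj : injective a := can_inj ac.
have S0im : c @: (a @: [set~ i0]) = [set~ i0].
  by rewrite -imset_comp (eq_imset _ ac) imset_id.
have I_gt0 : 0 < #|I| by apply/card_gt0P; exists i0.
rewrite (bigD1 (a @: [set~ i0])) //= sumE S0im eqxx andbT card_dominant_slack.
rewrite card_imset // cardsC1 prednK // eqxx muln1 oddD /=.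
elim/big_ind: _ => // [m n em en|D nD]; first by rewrite oddD (negbTE em).
rewrite sumE; have [/andP [/eqP cardD /eqP cD]|] := boolP (_ && _); last first.
  by rewrite mul0n.
rewrite mul1n.
have [->//|] := eqVneq #|[set y | (y \notin D) && dominant (y |: D)]| 0.
rewrite -lt0n => /card_gt0P [y]; rewrite inE => /andP [_ domy].
have domD : dominant D := dominantS _ _ (subsetUr _ _) domy.
(* A facet with a nonslack point has two completions, the slacks supplying the points above [x]. A
   facet of slacks with all colors but [i0] is the one already split off. *)
have [/existsP [x /andP [xD /forallP xa]]|] :=
    boolP [exists x, (x \in D) && [forall l, x != a l]].
  rewrite (card_dominant_setU1 D x) // => l; exists (a l) => m; exact: a_top.
rewrite negb_exists => /forallP noslack; move: nD.
suff -> : D = a @: [set~ i0] by rewrite eqxx.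
rewrite -cD -imset_comp; apply/setP => x; apply/idP/imsetP.
  move=> xD; have := noslack x; rewrite xD /= negb_forall => /existsP [l].
  by rewrite negbK => /eqP e; exists x; rewrite //= e ac.
move=> [z zD ->]; have := noslack z; rewrite zD /= negb_forall => /existsP [l].
by rewrite negbK => /eqP e; rewrite /= e ac -e.
Qed.

End Scarf.

(** * Colorings of the grid points of the simplex *)

(** Simplex points with denominator [N], scaled by [N]; the bound on coordinates makes this a finite
    type. *)
Definition grid (n N : nat) :=
  {x : {ffun 'I_n -> 'I_N.+1} | \sum_i (x i : nat) == N}.

Definition gcoord {n N : nat} (x : grid n N) (i : 'I_n) : nat := sval x i.

Lemma sum_gcoord {n N : nat} (x : grid n N) : \sum_i gcoord x i = N.
Proof. exact: (eqP (svalP x)). Qed.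

Lemma gridE (n N : nat) (g : 'I_n -> nat) : \sum_i g i = N ->
  exists x : grid n N, forall i, gcoord x i = g i.
Proof.
move=> sg; have gN i : g i < N.+1.
  by rewrite ltnS -sg (bigD1 i) //= leq_addr.
have sx : \sum_i ([ffun i => Ordinal (gN i)] i : nat) == N.
  by rewrite -[eqbRHS]sg; apply/eqP/eq_bigr => i _; rewrite ffunE.
by exists (exist (fun x : {ffun 'I_n -> 'I_N.+1} =>
  \sum_i (x i : nat) == N) _ sx) => i; rewrite /gcoord /= ffunE.
Qed.

Section GridOrders.
Variables n N : nat.
Local Notation T := (grid n N).

Definition gsize : nat := #|{: T}|.
Definition gindex (x : T) : nat := enum_rank x.

Lemma gindex_lt (x : T) : gindex x < gsize. Proof. exact: ltn_ord. Qed.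

Lemma gindex_inj : injective gindex.
Proof. by move=> x y e; apply/enum_rank_inj/val_inj. Qed.

(* The order [i] compares [i]-th coordinates and breaks ties by enumeration; the
   slack [inr i] is its least element and the other slacks are its largest. *)
Definition grank (i : 'I_n) (u : T + 'I_n) : nat :=
  match u with
  | inl x => (gcoord x i * gsize + gindex x).+1
  | inr j => if j == i then 0 else (N.+1 * gsize).+1 + j
  end.

Lemma grank_lt_slack (i j : 'I_n) (x : T) :
  i != j -> grank i (inl x) < grank i (inr j).
Proof.
rewrite /= eq_sym => /negbTE ->; have := gindex_lt x.
have : gcoord x i <= N by rewrite -ltnS; apply: ltn_ord.
rewrite -(leq_pmul2r (m := gsize)); first by rewrite mulSn; lia.
exact: leq_ltn_trans (gindex_lt x).
Qed.

Lemma grank_slack_min (i : 'I_n) (u : T + 'I_n) : grank i (inr i) <= grank i u.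
Proof. by rewrite /= eqxx. Qed.

Lemma grank_inj (i : 'I_n) : injective (grank i).
Proof.
have ne x j : grank i (inl x) != grank i (inr j).
  have [->|nij] := eqVneq i j; first by rewrite /= eqxx.
  by have := grank_lt_slack i j x nij; rewrite ltn_neqAle => /andP [].
move=> [x|j] [y|l] e; try by have := ne x l; rewrite e eqxx.
- congr inl; apply: gindex_inj; case: e => e.
  have := congr1 (fun z => z %% gsize) e.
  by rewrite !modnMDl !modn_small ?gindex_lt.
- by have := ne y j; rewrite e eqxx.
- congr inr; apply: val_inj; move: e => /=.
  by case: eqP => [->|_]; case: eqP => [->|_] //; lia.
Qed.

Lemma grank_gcoord (i : 'I_n) (x y : T) :
  grank i (inl x) <= grank i (inl y) -> gcoord x i <= gcoord y i.
Proof.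
rewrite /= ltnS => h; rewrite leqNgt; apply/negP => lt.
have := gindex_lt y; have : (gcoord y i).+1 <= gcoord x i by [].
rewrite -(leq_pmul2r (m := gsize)); first by rewrite mulSn; lia.
exact: leq_ltn_trans (gindex_lt x).
Qed.

End GridOrders.

(** The grid points of Scarf's set lie above a corner [m] whose coordinates sum to more than
    [N - n], so each exceeds [m] by at most [n] in any coordinate. A color supplied by a slack has
    [m i = 0], whence the first alternative. *)
Lemma grid_panchromatic (n N : nat) (c : grid n N -> 'I_n) : 0 < n ->
  exists x0 : grid n N, forall i, gcoord x0 i <= n \/
    exists x, c x = i /\ forall j,
      gcoord x j <= gcoord x0 j + n /\
      gcoord x0 j <= gcoord x j + n.
Proof.
move=> n_gt0; pose i0 := Ordinal n_gt0.
have sum_pred1 (l : 'I_n) : \sum_i (i == l : nat) = 1.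
  by rewrite (bigD1 l) //= eqxx big1 => // i /negbTE ->.
have [u0 _] : exists x : grid n N, forall i, gcoord x i = (i == i0) * N.
  by apply: gridE; rewrite -big_distrl /= sum_pred1 mul1n.
pose c' (u : grid n N + 'I_n) := match u with inl x => c x | inr j => j end.
have [||S /dominantP domS colS] := scarf _ _ (grank n N) (grank_inj n N) c' i0
    inr (fun=> erefl) (grank_slack_min n N) _ (inl u0) => //.
  move=> i j [x _|l /(_ l)]; [exact: grank_lt_slack | by rewrite eqxx].
pose C := [set i | inr i \notin S].
pose X : {set grid n N} := [set x | inl x \in S].
(* An order whose own slack is in [S] cannot be the witness, as that slack is below every grid
   point. *)
have step (y : grid n N) : exists2 i, i \in C &
    forall x, x \in X -> gcoord y i <= gcoord x i.
  have [i hi] := domS (inl y); exists i => [|x].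
    by rewrite inE; apply/negP => /hi; rewrite /= eqxx.
  by rewrite inE => /hi /grank_gcoord.
have color i : i \in C -> exists2 x, x \in X & c x = i.
  rewrite inE => iC; have : i \in c' @: S by rewrite colS inE.
  case/imsetP=> -[x|j] uS /= e; first by exists x; rewrite ?inE.
  by move: iC; rewrite e uS.
have [i1 i1C _] := step u0.
have [x0 x0X _] := color i1 i1C.
pose mn i := [arg min_(x < x0 in X) gcoord x i].
have mnX i : mn i \in X by rewrite /mn; case: arg_minnP.
have mn_le i x : x \in X -> gcoord (mn i) i <= gcoord x i.
  by rewrite /mn; case: arg_minnP => // z _ h /h.
pose m i := if i \in C then gcoord (mn i) i else 0.
have m_le i x : x \in X -> m i <= gcoord x i.
  by rewrite /m; case: ifP => // _; apply: mn_le.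
(* Otherwise there is room to raise [m] by one on all of [C]; with the remainder put on [i1], this
   is a grid point contradicting [step]. *)
have lt_m : N < \sum_i (m i + (i \in C)).
  rewrite ltnNge; apply/negP => le_m.
  pose g i := m i + (i \in C) + (i == i1) * (N - \sum_i (m i + (i \in C))).
  have [y hy] : exists y : grid n N, forall i, gcoord y i = g i.
    apply: gridE; rewrite big_split /= -big_distrl /= sum_pred1.
    by rewrite mul1n subnKC.
  have [i iC hi] := step y; have := hi _ (mnX i).
  by rewrite hy /g /m iC -addnA -{2}[gcoord _ _]addn0 leq_add2l.
have x_le x j : x \in X -> gcoord x j <= m j + n.
  move=> xX; have := sum_gcoord x; move: lt_m.
  have : \sum_i (i \in C) <= n.
    rewrite -[leqRHS]card_ord -sum1_card.
    by apply: leq_sum => i _; apply: leq_b1.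
  rewrite big_split /=.
  rewrite [\sum_i m i](bigD1 j) //= [\sum_i gcoord _ _](bigD1 j) //=.
  have : \sum_(i | i != j) m i <= \sum_(i | i != j) gcoord x i.
    by apply: leq_sum => i _; apply: m_le.
  move: (\sum_(i | i != j) m i) (\sum_(i | i != j) gcoord x i).
  by move: (\sum_i (i \in C)) (m j) (gcoord x j) => *; lia.
exists x0 => i; have [iC|iC] := boolP (i \in C); last first.
  by left; have := x_le _ i x0X; rewrite /m (negbTE iC).
right; have [x xX cx] := color i iC; exists x; split=> // j; split.
  by apply: leq_trans (x_le _ j xX) _; rewrite leq_add2r m_le.
by apply: leq_trans (x_le _ j x0X) _; rewrite leq_add2r m_le.
Qed.

(** * Brouwer's theorem on the simplex *)

From mathcomp Require Import all_classical all_reals all_analysis.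
Import numFieldNormedType.Exports.
Local Open Scope classical_set_scope.
Local Open Scope ring_scope.

Section Brouwer.
Variables (R : realType) (n : nat).
Hypothesis n_gt0 : (0 < n)%N.

Definition simplex : set 'rV[R]_n :=
  [set x | (forall i, 0 <= x ord0 i) /\ \sum_i x ord0 i = 1].

Lemma compact_simplex : compact simplex.
Proof.
have sum_cont : continuous (fun x : 'rV[R]_n => \sum_i x ord0 i).
  by apply: continuous_big => [|i _]; [exact: add_continuous
                                      |exact: coord_continuous].
have cube : compact [set x : 'rV[R]_n | forall i, `[0, 1]%classic (x ord0 i)].
  apply: (@rV_compact R n (fun=> `[0, 1]%classic)) => _.
  exact: segment_compact.
have -> : simplex = [set x : 'rV[R]_n | forall i, `[0, 1]%classic (x ord0 i)]
    `&` (fun x => \sum_i x ord0 i) @^-1` [set 1].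
  apply/seteqP; split=> x [x0 x1]; split=> //= i; last first.
    by have := x0 i; rewrite /= in_itv /= => /andP [].
  rewrite in_itv /= x0 -x1 (bigD1 i) //= lerDl.
  by apply: sumr_ge0 => j _.
apply: compact_closedI => //; apply: preimage_closed => [x _|]; first exact: sum_cont.
exact: closed_eq.
Qed.

(** The first alternative is harmless in the limit: there the coordinate becomes 0, which is at most
    that of [F]. Denominator [N.+1] avoids division by 0. *)
Lemma simplex_approx_fixpoint (F : 'rV[R]_n -> 'rV[R]_n) (N : nat) :
  (forall x, simplex x -> simplex (F x)) ->
  exists x0, simplex x0 /\ forall i, x0 ord0 i <= n%:R / N.+1%:R \/
    exists x, [/\ simplex x, x ord0 i <= F x ord0 i &
      forall j, `|x ord0 j - x0 ord0 j| <= n%:R / N.+1%:R].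
Proof.
move=> Fsimplex.
pose p (x : grid n N.+1) : 'rV[R]_n := \row_i ((gcoord x i)%:R / N.+1%:R).
have pS x : simplex (p x).
  split=> [i|]; first by rewrite mxE divr_ge0.
  under eq_bigr do rewrite mxE.
  by rewrite -mulr_suml -natr_sum sum_gcoord divff.
(* Both vectors sum to 1, so one cannot be strictly larger in every coordinate. *)
have label x : {i | p x ord0 i <= F (p x) ord0 i}.
  apply/sigW/existsP; apply: contraT; rewrite negb_exists => /forallP lt.
  have [_ sp] := pS x; have [_ sF] := Fsimplex _ (pS x).
  suff : \sum_i F (p x) ord0 i < \sum_i p x ord0 i by rewrite sp sF ltxx.
  apply: ltr_sum => [|i _]; last by rewrite real_ltNge ?num_real.
  by apply/hasP; exists (Ordinal n_gt0); rewrite ?mem_index_enum.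
have [x0 hx0] := grid_panchromatic n N.+1 (fun x => sval (label x)) n_gt0.
have pB x y j : (gcoord x j <= gcoord y j + n)%N ->
    p x ord0 j - p y ord0 j <= n%:R / N.+1%:R.
  move=> le; rewrite !mxE -mulrBl ler_pM2r ?invr_gt0 ?ltr0n //.
  by rewrite lerBlDl -natrD ler_nat.
exists (p x0); split=> // i; case: (hx0 i) => [le|[x [cx close]]]; [left|right].
  by rewrite mxE ler_pM2r ?invr_gt0 ?ltr0n // ler_nat.
exists (p x); split=> [//||j]; first by rewrite -cx; apply: (svalP (label x)).
have [le1 le2] := close j.
by rewrite ler_norml pB // andbT lerNl opprB pB.
Qed.

Theorem brouwer_simplex (F : 'rV[R]_n -> 'rV[R]_n) :
  (forall i, continuous (fun x => F x ord0 i)) ->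
  (forall x, simplex x -> simplex (F x)) ->
  exists2 x, simplex x & F x = x.
Proof.
move=> Fcont Fsimplex.
have [u hu] := choice (fun N => simplex_approx_fixpoint F N Fsimplex).
have [z [zS zu]] : simplex `&` cluster (u @ \oo) !=set0.
  apply: compact_simplex; exists 0%N => // N _; exact: (hu N).1.
have FzS := Fsimplex z zS.
exists z => //.
have le_zF i : z ord0 i <= F z ord0 i.
  apply/ler_addgt0Pr => e e_gt0.
  have Gcont : {for z, continuous (fun x => F x ord0 i - x ord0 i)}.
    apply: (@continuousB _ _ _ (fun x : 'rV[R]_n => F x ord0 i)).
      exact: Fcont.
    exact: coord_continuous.
  have /cvgrPdist_lt /(_ e e_gt0) /nbhs_ballP [d /= d_gt0 hd] := Gcont.
  (* Two errors below [r] add up: from [z] to [u N] to [x] they must stay within [d], and in the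
     small-coordinate case within [e]. *)
  pose r := Num.min (d / 2) (e / 2).
  have r_gt0 : 0 < r by rewrite lt_min !divr_gt0.
  have rn_gt0 : 0 < r / n%:R by rewrite divr_gt0 ?ltr0n.
  (* Recording the index in the event lets the cluster property return a large [N] with [u N] close
     to [z]. *)
  have nearN : \forall x \near u @ \oo, exists2 N, x = u N & n%:R / N.+1%:R < r.
    have := near_infty_natSinv_lt (PosNum rn_gt0).
    apply: filterS => N /= hN; exists N => //.
    by rewrite mulrC -ltr_pdivlMr ?ltr0n.
  have [_ [[N -> ltN] [_ zN]]] := zu _ _ nearN (nbhsx_ballx z r r_gt0).
  have zNj j : `|z ord0 j - u N ord0 j| < r by exact: zN.
  have rd : r <= d / 2 by rewrite ge_min lexx.
  have re : r <= e / 2 by rewrite ge_min lexx orbT.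
  have [_ /(_ i) [small|[x [xS xF xN]]]] := hu N.
    have := zNj i; rewrite ltr_norml => /andP [_ lt].
    have [/(_ i) Fz_ge0 _] := FzS.
    have {small ltN} := le_lt_trans small ltN; lra.
  have zx : ball z d x.
    split=> // a j; rewrite (ord1 a) -ball_normE /=.
    rewrite -(subrKA (u N ord0 j)); apply: le_lt_trans (ler_normD _ _) _.
    rewrite [`|u N _ _ - _|]distrC; have := zNj j.
    have := le_lt_trans (xN j) ltN; lra.
  have := hd x zx; rewrite /= ltr_norml => /andP [lt _]; lra.
(* The coordinates of [F z - z] are nonnegative and sum to 0. *)
apply/rowP => i; apply/eqP; rewrite -subr_eq0; apply/eqP.
have [_ sz] := zS; have [_ sF] := FzS.
apply: (@psumr_eq0P _ _ xpredT (fun i => F z ord0 i - z ord0 i)) => //.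
  by move=> j _; rewrite subr_ge0.
by rewrite sumrB sz sF subrr.
Qed.

End Brouwer.

(** * Tensors *)

Lemma prod_scale_tuple (R : comPzRingType) (m n : nat) (t : m.-tuple 'I_n)
    (s : R) (y : 'I_n -> R) :
  \prod_(j <- t) (s * y j) = s ^+ m * \prod_(j <- t) y j.
Proof.
by rewrite big_split /= big_const_seq count_predT size_tuple iter_mulr_1.
Qed.

Lemma sum_tuple_prod (R : comPzRingType) (m n : nat) (y : 'I_n -> R) :
  \sum_(t : m.-tuple 'I_n) \prod_(j <- t) y j = (\sum_j y j) ^+ m.
Proof.
rewrite -[in RHS](card_ord m) -prodr_const bigA_distr_bigA /=.
rewrite (reindex (@tuple_of_finfun 'I_n m)) /=; last first.
  by exists (@finfun_of_tuple 'I_n m) => x _;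
    rewrite ?tuple_of_finfunK ?finfun_of_tupleK.
by apply: eq_bigr => h _; rewrite big_map big_enum.
Qed.

Section TensorApply.
Variables (R : realType) (k n : nat) (P : tensor R k n).

Lemma tapply_scale (s : R) (y : 'I_n -> R) (i : 'I_n) :
  tapply P (fun j => s * y j) i = s ^+ k.-1 * tapply P y i.
Proof.
rewrite /tapply mulr_sumr; apply: eq_bigr => t _.
by rewrite prod_scale_tuple mulrCA.
Qed.

Hypothesis hP : col_substochastic P.

Lemma tapply_ge0 (y : 'I_n -> R) (i : 'I_n) :
  (forall j, 0 <= y j) -> 0 <= tapply P y i.
Proof.
move=> y_ge0; apply: sumr_ge0 => t _; apply: mulr_ge0; first exact: hP.1.
exact: prodr_ge0.
Qed.

(** Exchanging the sums exposes the column sums, each at most 1; the remaining sum over tuples is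
    the expanded power. *)
Lemma sum_tapply_le (y : 'I_n -> R) :
  (forall j, 0 <= y j) -> \sum_i tapply P y i <= (\sum_j y j) ^+ k.-1.
Proof.
move=> y_ge0; rewrite -sum_tuple_prod /tapply exchange_big /=.
apply: ler_sum => t _; rewrite -mulr_suml -[leRHS]mul1r.
by rewrite ler_wpM2r ?hP.2 // prodr_ge0.
Qed.

End TensorApply.

Lemma tapply_continuous (R : realType) (k n : nat) (P : tensor R k n)
    (i : 'I_n) : continuous (fun x : 'rV[R]_n => tapply P (x ord0) i).
Proof.
apply: continuous_big => [|t _]; first exact: add_continuous.
move=> x; apply: (@cvgMl_tmp _ _ (nbhs x) _
  (fun x : 'rV[R]_n => \prod_(j <- t) x ord0 j)).
apply: continuous_big => [|j _]; first exact: mul_continuous.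
exact: coord_continuous.
Qed.

Theorem theorem3p6 (R : realType) (k n : nat) (hk : (2 <= k)%N) (hn : (1 <= n)%N)
  (P : tensor R k n) (v : 'I_n -> R) (alpha : R)
  (hP : col_substochastic P) (hv : stochastic_vec v)
  (ha0 : 0 <= alpha) (ha1 : alpha < 1) :
  exists y : 'I_n -> R,
    (forall i, 0 <= y i) /\ (exists i, y i != 0) /\ mlppr_sol alpha P v y.
Proof.
have [v_ge0 sum_v] := hv.
pose b (x : 'rV[R]_n) := \sum_i tapply P (x ord0) i.
pose F (x : 'rV[R]_n) : 'rV[R]_n :=
  \row_i (alpha * tapply P (x ord0) i + (1 - alpha * b x) * v i).
have b_lt1 x : simplex R n x -> 0 < 1 - alpha * b x.
  move=> [x_ge0 sum_x]; rewrite subr_gt0; apply: le_lt_trans ha1.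
  rewrite -[leRHS]mulr1 ler_wpM2l // -(expr1n _ k.-1) -sum_x.
  exact: sum_tapply_le.
have [|x xS|x xS Fx] := brouwer_simplex R n hn F.
- move=> i; rewrite /F; under eq_fun do rewrite mxE.
  have b_cont : continuous b.
    apply: continuous_big => [|j _]; first exact: add_continuous.
    exact: tapply_continuous.
  move=> x; apply: (@cvgD _ _ _ (nbhs x) _
      (fun x : 'rV[R]_n => alpha * tapply P (x ord0) i)
      (fun x => (1 - alpha * b x) * v i)).
    exact: (@cvgMl_tmp _ _ _ _ _ _ _ (tapply_continuous R k n P i x)).
  apply: (@cvgMr_tmp _ _ (nbhs x) _ (fun x => 1 - alpha * b x)).
  apply: (@cvgB _ _ _ (nbhs x) _ (fun=> 1 : R) (fun x => alpha * b x)).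
    exact: cvg_cst.
  exact: (@cvgMl_tmp _ _ _ _ _ _ _ (b_cont x)).
- have [x_ge0 sum_x] := xS; split=> [i|].
    rewrite mxE addr_ge0 ?mulr_ge0 ?tapply_ge0 //.
    exact/ltW/b_lt1.
  under eq_bigr do rewrite mxE.
  by rewrite big_split /= -!mulr_sumr sum_v mulr1 addrC subrK.
have b_gt0 := b_lt1 x xS; have [x_ge0 sum_x] := xS.
have k_gt0 : (0 < k.-1)%N by rewrite -subn1 subn_gt0.
(* The scale making [s ^+ k.-1] cancel the coefficient of [v] in the fixed point equation. *)
pose s := (1 - alpha * b x)^-1 `^ (k.-1%:R^-1).
have s_gt0 : 0 < s by rewrite powR_gt0 // invr_gt0.
have sE : s ^+ k.-1 = (1 - alpha * b x)^-1.
  rewrite -powR_mulrn ?ltW // -powRrM mulVf ?powRr1 ?ltW ?invr_gt0 //.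
  by rewrite pnatr_eq0 -lt0n.
have sum_y : \sum_j s * x ord0 j = s by rewrite -mulr_sumr sum_x mulr1.
exists (fun i => s * x ord0 i); split=> [i|]; first by rewrite mulr_ge0 // ltW.
split.
  apply/existsP; apply: contraT; rewrite negb_exists => /forallP y0.
  move: s_gt0; rewrite -sum_y big1 ?ltxx // => i _.
  by apply/eqP; have := y0 i; rewrite negbK.
move=> i; rewrite sum_y tapply_scale mulrA -exprSr.
have -> : (k - 2).+1 = k.-1 by rewrite subnS subn1 prednK.
have := congr1 (fun z : 'rV[R]_n => z ord0 i) Fx; rewrite mxE => Fxi.
(* Expanding only the linear occurrence of [x] by the fixed point equation cancels the tensor
   terms. *)
rewrite -{1}Fxi mulrDr mulrCA addrAC subrr add0r mulrA sE mulVf ?mul1r //.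
exact: lt0r_neq0.
Qed.
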